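(* Let $\rho$ be an $n$-qubit density operator, $\mathcal U$ a unitary channel, $\mathcal E$ a noise channel (so the implemented noisy operation is $\tilde{\mathcal U}=\mathcal E\,\mathcal U$), and let $F=\sum_{b\in\{0,1\}^n} f(b)\,|b\rangle\langle b|$ with $f(b)\in\mathbb R$. Suppose there is an invertible linear map $\mathcal E'$ with $\mathcal E'\mathcal M_{\mathbb Z}=\mathcal M_{\mathbb Z}\mathcal E$, and let $\mathcal E'^{-1}=\sum_{\mathcal B\in\mathbb B}Q'_{\mathcal B}\,\mathcal B$ with real coefficients $Q'_{\mathcal B}$ and $\gamma'=\sum_{\mathcal B\in\mathbb B}|Q'_{\mathcal B}|$. Let $b$ be a one-shot outcome of measuring $\tilde{\mathcal U}(\rho)$ in the computational basis, i.e. $\Pr(b)=\langle\langle b|\mathcal E\,\mathcal U|\rho\rangle\rangle$, and let $\mathcal B$ be drawn from $\mathbb B$, independently of $b$, with probability $\Pr(\mathcal B)=|Q'_{\mathcal B}|/\gamma'$. Then $$\hat f_{b,\mathcal B}=\gamma'\,\frac{Q'_{\mathcal B}}{|Q'_{\mathcal B}|}\,\langle\langle F|\mathcal B|b\rangle\rangle$$ is an unbiased estimator of $f=\langle\langle F|\mathcal M_{\mathbb Z}\,\mathcal U|\rho\rangle\rangle$. Moreover, suppose the noisy circuit is measured for $K$ independent shots, with outcomes $b_1,\dots,b_K$, and, for each shot $k$, $L$ independent instances $\mathcal B_{k,1},\dots,\mathcal B_{k,L}$ of $\mathcal B$ are generated, and let $\hat f_{\mathrm{tot}}=\frac1{KL}\sum_{k=1}^K\sum_{l=1}^L\hat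 f_{b_k,\mathcal B_{k,l}}$ be the mean of the resulting $K\times L$ estimators $\hat f_{b_k,\mathcal B_{k,l}}=\gamma'\,\frac{Q'_{\mathcal B_{k,l}}}{|Q'_{\mathcal B_{k,l}}|}\,\langle\langle F|\mathcal B_{k,l}|b_k\rangle\rangle$. Then $$\operatorname{Var}[\hat f_{\mathrm{tot}}]\le\frac{\gamma'^2}{K}\left(\frac1L\|F\|_\star^2+\Big(1-\frac1L\Big)\|F\|_\circ^2\right),$$ where the semi-norms $\|\cdot\|_\star$ and $\|\cdot\|_\circ$ (defined in the context) satisfy $\|\cdot\|_\circ\le\|\cdot\|_\star\le\|\cdot\|_\infty$, with $\|\cdot\|_\infty$ the Schatten $\infty$-norm.
   Context: For operators on $(\mathbb C^2)^{\otimes n}$, $|A\rangle\rangle$ is the vectorization of $A$, with $\langle\langle A|B\rangle\rangle=\operatorname{Tr}(A^\dagger B)$; linear maps on operators act as matrices on vectorized operators, $\langle\langle A|\mathcal E|B\rangle\rangle=\operatorname{Tr}(A^\dagger\mathcal E(B))$, and juxtaposition is composition. For a bit string $b\in\{0,1\}^n$, $|b\rangle\rangle$ denotes the vectorization of $|b\rangle\langle b|$. $\mathcal M_{\mathbb Z}=\sum_{b\in\{0,1\}^n}|b\rangle\rangle\langle\langle b|$ is the computational-basis measurement (completely dephasing) channel. The unitary channel is $\mathcal U(\rho)=U\rho U^\dagger$. The noise $\mathcal E=\tilde{\mathcal U}\mathcal U^\dagger$ is a quantum channel (CPTP map). $\mathbb B$ is a finite set of basis operations, each a completely positive trace-non-increasing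 map (e.g. Clifford channels and projections $\rho\mapsto P\rho P$ onto Pauli eigenstates). In the $K\times L$ scheme, shot $k$ has outcome $b_k$ and instances $\mathcal B_{k,1},\dots,\mathcal B_{k,L}$, all mutually independent, each $b_k$ distributed with $\Pr(b)=\langle\langle b|\mathcal E\,\mathcal U|\rho\rangle\rangle$ and each $\mathcal B_{k,l}$ with $\Pr(\mathcal B)=|Q'_{\mathcal B}|/\gamma'$, and $\hat f_{\mathrm{tot}}=\frac1{KL}\sum_{k,l}\hat f_{b_k,\mathcal B_{k,l}}$. With $\operatorname{sgn}(\mathcal B)=Q'_{\mathcal B}/|Q'_{\mathcal B}|$, the semi-norms are (maxima over density operators $\rho$) $$\|F\|_\star=\max_\rho\Big(\sum_b\langle\langle b|\mathcal E\,\mathcal U|\rho\rangle\rangle\sum_{\mathcal B}\Pr(\mathcal B)\,\langle\langle F|\mathcal B|b\rangle\rangle^2\Big)^{1/2},$$ $$\|F\|_\circ=\max_\rho\Big(\sum_b\langle\langle b|\mathcal E\,\mathcal U|\rho\rangle\rangle\Big(\sum_{\mathcal B}\Pr(\mathcal B)\operatorname{sgn}(\mathcal B)\langle\langle F|\mathcal B|b\rangle\rangle\Big)^2\Big)^{1/2}.$$ *)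

(* Defs.v *)
From HB Require Import structures.
From mathcomp Require Import all_boot all_order all_algebra.
From mathcomp Require Import finmap complex ring.
From mathcomp Require Import all_classical all_reals all_analysis.

Set Implicit Arguments.
Unset Strict Implicit.
Unset Printing Implicit Defensive.

Import Order.TTheory GRing.Theory Num.Theory.
Local Open Scope ring_scope.
Local Open Scope complex_scope.
Local Open Scope sesquilinear_scope.
Local Open Scope classical_set_scope.

(** (C^2)^{(x) n} has its computational basis labelled by bit strings, so an
    operator on it is a square matrix of size #|{0,1}^n| = 2^n; the row or
    column of the bit string b is [enum_rank b]. *)
Notation bits n := (n.-tuple bool).
Notation op R n := 'M[R[i]]_(#|{: bits n}|).
Notation superop R n := 'End(op R n).

Section operators.
Variables (R : realType) (n : nat).
Implicit Types (A B F X rho : op R n) (Phi : superop R n) (b : bits n).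

Definition ketbra b : op R n := delta_mx (enum_rank b) (enum_rank b).

Definition braket A Phi B : R[i] := \tr (A^t* *m Phi B).

(** <<A|Phi|B>> as an element of R: it is real when A is Hermitian and Phi B is
    positive semidefinite, see [braket_real] below; in particular when A is an
    observable or a projector, Phi is completely positive and B is a state. *)
Definition rbraket A Phi B : R := complex.Re (braket A Phi B).

Definition is_hermitian m (A : 'M[R[i]]_m) : Prop := A^t* = A.

(** The order of R[i] makes [0 <= z] include that z is real. *)
Definition psd m (A : 'M[R[i]]_m) : Prop :=
  forall v : 'cV[R[i]]_m, 0 <= (v^t* *m A *m v) 0 0.

Definition density rho : Prop := psd rho /\ \tr rho = 1.

(** id_k (x) Phi acts on k x k block matrices by applying Phi to each block. *)
Definition completely_positive Phi : Prop :=
  forall (k : nat)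
    (X : 'M[R[i]]_(\sum_(i < k) #|{: bits n}|, \sum_(i < k) #|{: bits n}|)),
    psd X -> psd (\mxblock_(i < k, j < k) Phi (submxblock X i j)).

Definition trace_preserving Phi : Prop := forall X, \tr (Phi X) = \tr X.

Definition trace_nonincreasing Phi : Prop :=
  forall X, psd X -> \tr (Phi X) <= \tr X.

Definition quantum_channel Phi : Prop :=
  completely_positive Phi /\ trace_preserving Phi.

(** [linfun] packs a function as an element of 'End; it is the given function
    only when that function is linear, see [unitary_channelE], [dephasingE]. *)
Definition unitary_channel (U : op R n) : superop R n :=
  linfun (fun X => U *m X *m U^t*).

Definition dephasing : superop R n :=
  linfun (fun X => \sum_b \tr ((ketbra b)^t* *m X) *: ketbra b).

Definition diag_observable (f : bits n -> R) : op R n :=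
  \sum_b (f b)%:C *: ketbra b.

(** Largest singular value; the singular values of A are the nonnegative
    square roots of the eigenvalues of A^dagger A. *)
Definition schatten_infty A : R :=
  sup [set s : R | 0 <= s /\ eigenvalue (A^t* *m A) (s ^+ 2)%:C].

Lemma unitary_channelE U X : unitary_channel U X = U *m X *m U^t*.
Proof.
have lin : linear (fun X : op R n => U *m X *m U^t*).
  by move=> a Y Z; rewrite mulmxDr mulmxDl -scalemxAr -scalemxAl.
pose L : {linear op R n -> op R n} := HB.pack (fun X : op R n => U *m X *m U^t*)
  (GRing.isLinear.Build R[i] (op R n) (op R n) *:%R _ lin).
exact: (lfunE L X).
Qed.

Lemma dephasingE X :
  dephasing X = \sum_b \tr ((ketbra b)^t* *m X) *: ketbra b.
Proof.
pose D X : op R n := \sum_b \tr ((ketbra b)^t* *m X) *: ketbra b.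
have lin : linear D.
  move=> a Y Z; rewrite /D scaler_sumr -big_split /=; apply: eq_bigr => b _.
  by rewrite mulmxDr -scalemxAr mxtraceD mxtraceZ scalerDl scalerA.
pose L : {linear op R n -> op R n} := HB.pack D
  (GRing.isLinear.Build R[i] (op R n) (op R n) *:%R D lin).
exact: (lfunE L X).
Qed.

Lemma psd_hermitian m (A : 'M[R[i]]_m) : psd A -> is_hermitian A.
Proof.
move=> Apsd; pose q (u v : 'cV[R[i]]_m) := (u^t* *m A *m v) 0 0.
have qe i j : q (delta_mx i 0) (delta_mx j 0) = A i j.
  by rewrite /q trmx_delta map_delta_mx -rowE -colE !mxE.
have qJ u : Num.conj (q u u) = q u u by apply/CrealP/ger0_real/Apsd.
have qD u v c : q (u + c *: v) (u + c *: v)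
    = q u u + c * q u v + Num.conj c * q v u + Num.conj c * c * q v v.
  rewrite /q; have -> : (u + c *: v)^t* = u^t* + Num.conj c *: v^t*.
    by apply/matrixP => k l; rewrite !mxE rmorphD rmorphM.
  rewrite !(mulmxDl, mulmxDr) -!scalemxAl -!scalemxAr.
  move: (u^t* *m A *m u) (u^t* *m A *m v) (v^t* *m A *m u) (v^t* *m A *m v).
  by move=> a1 a2 a3 a4; rewrite !mxE; ring.
apply/matrixP => i j; rewrite !mxE -!qe.
set u := delta_mx i 0; set v := delta_mx j 0.
have := qJ (u + 1 *: v); have := qJ (u + 'i%R *: v).
rewrite !qD conjCi !rmorph1 !mul1r !mulNr -expr2 sqrCi mulN1r opprK.
rewrite !rmorphD rmorphN !rmorphM /= !qJ conjCi.
move: (q u u) (q v v) (q u v) (q v u) => a c x y.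
move=> /addIr; rewrite -!addrA => /addrI e1 /addrI; rewrite !addrA => /addIr e2.
have {}e1 : x - y = Num.conj y - Num.conj x.
  apply: (mulfI (@neq0Ci R[i])).
  by rewrite mulrBr -e1; ring.
have h : 2%:R * Num.conj y = 2%:R * x.
  have -> : 2%:R * x = (x + y) + (x - y) by ring.
  by rewrite e1 -e2; ring.
by apply: (mulfI _ h); rewrite pnatr_eq0.
Qed.

Lemma braket_real A Phi B : is_hermitian A -> psd (Phi B) ->
  (rbraket A Phi B)%:C = braket A Phi B.
Proof.
move=> hA /psd_hermitian hB; suff h : Num.conj (braket A Phi B) = braket A Phi B.
  by apply: RRe_real; apply/CrealP.
rewrite /braket hA -trace_map_mx -mxtrace_tr map_mxM trmx_mul.
by rewrite !map_trmx hB hA mxtrace_mulC.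
Qed.

End operators.

Section estimator.
Variables (R : realType) (n : nat) (BB : {fset superop R n}) (Q : BB -> R).
Implicit Types (F : op R n) (E U : superop R n).

Definition gamma : R := \sum_(B : BB) `|Q B|.

Definition prB (B : BB) : R := `|Q B| / gamma.

(** Equal to 0 when [Q B = 0], in which case B has probability 0. *)
Definition sgnB (B : BB) : R := Q B / `|Q B|.

Definition estimator F (b : bits n) (B : BB) : R :=
  gamma * sgnB B * rbraket F (val B) (ketbra R b).

Definition prb E U rho (b : bits n) : R := rbraket (ketbra R b) (E \o U)%VF rho.

(** The suprema below are the maxima over density operators: the set of
    density operators is compact and the functions are continuous. *)
Definition star_norm E U F : R :=
  sup [set Num.sqrt (\sum_b prb E U rho b *
         \sum_(B : BB) prB B * rbraket F (val B) (ketbra R b) ^+ 2)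
      | rho in @density R n].

Definition circ_norm E U F : R :=
  sup [set Num.sqrt (\sum_b prb E U rho b *
         (\sum_(B : BB) prB B * sgnB B * rbraket F (val B) (ketbra R b)) ^+ 2)
      | rho in @density R n].

End estimator.

Section random_elements.
Context {d : measure_display} {T : measurableType d} {R : realType}.
Variable P : probability T R.
Local Open Scope ereal_scope.

(** Measurability of a random element with values in a finite set. *)
Definition discrete_rv (V : finType) (X : T -> V) : Prop :=
  forall v, measurable (X @^-1` [set v]).

Definition has_law (V : finType) (X : T -> V) (p : V -> R) : Prop :=
  discrete_rv X /\ forall v, P (X @^-1` [set v]) = (p v)%:E.

Definition independent (V W : finType) (X : T -> V) (Y : T -> W) : Prop :=
  forall (A : set V) (B : set W),
    P (X @^-1` A `&` Y @^-1` B) = P (X @^-1` A) * P (Y @^-1` B).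

Definition mutually_independent (I : finType) (V : I -> finType)
    (X : forall i, T -> V i) : Prop :=
  forall (J : {set I}) (A : forall i, set (V i)),
    P (\bigcap_(i in [set` J]) (X i @^-1` A i))
    = \prod_(i in J) P (X i @^-1` A i).

End random_elements.

Definition total_estimator (R : realType) (n : nat) (BB : {fset superop R n})
    (Q : BB -> R) (F : op R n) (K L : nat)
    (b : 'I_K -> bits n) (B : 'I_K -> 'I_L -> BB) : R :=
  (K%:R * L%:R)^-1 * \sum_(k < K) \sum_(l < L) estimator Q F (b k) (B k l).

(** The K outcomes and the K * L instances as one heterogeneous family. *)
Definition scheme_val (V W : finType) (K L : nat) (i : 'I_K + 'I_K * 'I_L) :
  finType := match i with inl _ => V | inr _ => W end.

Definition scheme_family (T : Type) (V W : finType) (K L : nat)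
    (b : 'I_K -> T -> V) (B : 'I_K -> 'I_L -> T -> W)
    (i : 'I_K + 'I_K * 'I_L) : T -> scheme_val V W i :=
  match i with inl k => b k | inr kl => B kl.1 kl.2 end.

(* Main.v *)
(** Unbiasedness: the outcome law is the diagonal of the noisy state, so
    averaging [|b>><<b|] over it gives [M_Z E U rho = E' M_Z U rho], and the
    average over the basis operations applies the inverse of [E'].

    Variance: distinct shots are independent, so centring the estimators kills
    every cross term between shots.  Within a shot, the [L] diagonal terms give
    the star norm; in the [L (L - 1)] off-diagonal ones the instances are
    independent given the outcome, so that the inner average is squared, which
    gives the circ norm.

    Norms: [circ <= star] is Jensen's inequality in each outcome, and
    [star <= Schatten] holds because every [B(|b><b|)] is positive semidefinite
    of trace at most 1. *)
Require Import Defs.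
From HB Require Import structures.
From mathcomp Require Import all_boot all_order all_algebra.
From mathcomp Require Import finmap complex ring lra.
From mathcomp Require Import all_classical all_reals all_analysis.
Import Order.TTheory GRing.Theory Num.Theory.
Local Open Scope ring_scope.

Set Implicit Arguments.
Unset Strict Implicit.
Unset Printing Implicit Defensive.

(** * Expectation and variance of random elements with finitely many values *)

Section finite_valued.
Context {d : measure_display} {T : measurableType d} {R : realType}.
Variable P : probability T R.
Local Open Scope classical_set_scope.

(** The composite with [g] is a finite linear combination of indicators of the fibres of [Z], each
    integrable because [P] is finite, so the integral can be taken term by term. *)
Lemma expectation_discrete (V : finType) (Z : T -> V) (g : V -> R) :
  discrete_rv Z ->
  'E_P[fun w => g (Z w)]%E
  = (\sum_v g v * fine (P (Z @^-1` [set v])))%:E.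
Proof.
move=> mZ; rewrite unlock.
have -> : (fun w => (g (Z w))%:E) =
    (fun w => \sum_(v : V) (g v)%:E * (\1_(Z @^-1` [set v]) w)%:E)%E.
  apply/funext => w; rewrite (bigD1 (Z w)) //= big1 => [|v vZ].
    by rewrite indicE mem_set // mule1 adde0.
  by rewrite indicE memNset ?mule0 // => /= e; rewrite e eqxx in vZ.
have intI v : P.-integrable setT (fun w => (\1_(Z @^-1` [set v]) w)%:E).
  by apply: integrable_indic.
rewrite integral_sum //=; last by move=> v; apply: integrableZl.
rewrite -sumEFin; apply: eq_bigr => v _.
rewrite integralZl // integral_indic // setIT EFinM fineK //.
exact: fin_num_measure.
Qed.

Lemma expectation_discrete_sum (V I : finType) (Z : T -> V) (h : I -> V -> R) :
  discrete_rv Z ->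
  fine 'E_P[fun w => (\sum_i h i (Z w))%R]%E = \sum_i fine 'E_P[fun w => h i (Z w)]%E.
Proof.
move=> mZ; rewrite (@expectation_discrete _ Z (fun v => \sum_i h i v)) //=.
under [RHS]eq_bigr do rewrite expectation_discrete //=.
by rewrite exchange_big; apply: eq_bigr => v _; rewrite mulr_suml.
Qed.

Lemma expectation_discreteZ (V : finType) (Z : T -> V) (c : R) (h : V -> R) :
  discrete_rv Z ->
  fine 'E_P[fun w => (c * h (Z w))%R]%E = c * fine 'E_P[fun w => h (Z w)]%E.
Proof.
move=> mZ; rewrite (@expectation_discrete _ Z (fun v => c * h v)) //=.
rewrite expectation_discrete //= mulr_sumr.
by apply: eq_bigr => v _; rewrite mulrA.
Qed.

Lemma variance_discrete (V : finType) (Z : T -> V) (g : V -> R) :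
  discrete_rv Z ->
  'V_P[fun w => g (Z w)]%E =
  (fine 'E_P[fun w => ((g (Z w) - fine 'E_P[fun w => g (Z w)]) ^+ 2)%R]%E)%:E.
Proof.
move=> mZ; rewrite /variance [in LHS]unlock.
set m := fine _.
rewrite (@expectation_discrete _ Z (fun v => (g v - m) ^+ 2)) //=.
Qed.

Lemma discrete_rv_pair (V W : finType) (X : T -> V) (Y : T -> W) :
  discrete_rv X -> discrete_rv Y -> discrete_rv (fun w => (X w, Y w)).
Proof.
move=> mX mY [x y].
have -> : (fun w => (X w, Y w)) @^-1` [set (x, y)]
    = X @^-1` [set x] `&` Y @^-1` [set y].
  by apply/seteqP; split=> w /=; [case=> -> ->|case=> -> ->].
exact: measurableI.
Qed.

(** Packs a finite family of draws into a single finite-valued element; each fibre is a finite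
    intersection of fibres of the components. *)
Lemma discrete_rv_ffun (I V : finType) (X : I -> T -> V) :
  (forall i, discrete_rv (X i)) -> discrete_rv (fun w => [ffun i => X i w]).
Proof.
move=> mX x.
have -> : (fun w => [ffun i => X i w]) @^-1` [set x]
    = \bigcap_(i in [set` setT]) (X i @^-1` [set x i]).
  apply/seteqP; split=> w /=.
    by move=> <- i _ /=; rewrite ffunE.
  by move=> h; apply/ffunP => i; rewrite ffunE; apply: h; rewrite /= inE.
by apply: fin_bigcap_measurable => // i _; apply: mX.
Qed.

Lemma expectation_law (V : finType) (Z : T -> V) (p : V -> R) (g : V -> R) :
  has_law P Z p -> 'E_P[fun w => g (Z w)]%E = (\sum_v g v * p v)%:E.
Proof.
move=> [mZ pZ]; rewrite expectation_discrete //; congr EFin.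
by apply: eq_bigr => v _; rewrite pZ.
Qed.

(** Both sides compute the expectation of the constant 1. *)
Lemma has_law_sum1 (V : finType) (Z : T -> V) (p : V -> R) :
  has_law P Z p -> \sum_v p v = 1.
Proof.
move=> /(@expectation_law _ _ p (fun=> 1)); rewrite -/(cst _) expectation_cst.
by move=> [->]; apply: eq_bigr => v _; rewrite mul1r.
Qed.

(** Independence is asked on single points only, so the lemma can be iterated on nested pairs with
    product events taken from mutual independence. *)
Lemma has_law_pair (V W : finType) (X : T -> V) (Y : T -> W)
    (p : V -> R) (q : W -> R) :
  has_law P X p -> has_law P Y q ->
  (forall x y, P (X @^-1` [set x] `&` Y @^-1` [set y])
     = (P (X @^-1` [set x]) * P (Y @^-1` [set y]))%E) ->
  has_law P (fun w => (X w, Y w)) (fun z => p z.1 * q z.2).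
Proof.
move=> [mX pX] [mY pY] ind; split; first exact: discrete_rv_pair.
move=> [x y] /=; rewrite EFinM -pX -pY -ind; congr (P _).
by apply/seteqP; split=> w /=; [case=> -> ->|case=> -> ->].
Qed.

(** * Joint laws in the scheme of [K] shots with [L] instances each, and the variance bound *)

Section scheme.
Variables (V W : finType) (K L : nat).
Variables (b : 'I_K -> T -> V) (B : 'I_K -> 'I_L -> T -> W).
Variables (p : V -> R) (q : W -> R).
Hypothesis lawb : forall k, has_law P (b k) p.
Hypothesis lawB : forall k l, has_law P (B k l) q.
Hypothesis indep : mutually_independent P (scheme_family b B).

Lemma scheme_law k l :
  has_law P (fun w => (b k w, B k l w)) (fun z => p z.1 * q z.2).
Proof.
apply: has_law_pair => // x y.
pose A (i : 'I_K + 'I_K * 'I_L) : set (scheme_val V W i) :=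
  match i with inl _ => [set x] | inr _ => [set y] end.
have := indep (inl k |: [set inr (k, l)]) A.
rewrite big_setU1 ?inE //= big_set1 /= => <-; congr (P _).
apply/seteqP; split=> w /=.
  by move=> [wx wy] i /=; rewrite !inE => /orP[] /eqP ->.
by move=> h; split; [apply: (h (inl k)) | apply: (h (inr (k, l)))];
  rewrite /= !inE eqxx ?orbT.
Qed.

(** Two instances of one shot share the outcome: [p] occurs once and [q] twice. This is the law
    behind the off-diagonal terms within a shot. *)
Lemma scheme_law_same_shot k l l' : l != l' ->
  has_law P (fun w => (b k w, (B k l w, B k l' w)))
    (fun z => p z.1 * (q z.2.1 * q z.2.2)).
Proof.
move=> ll'.
have law2 : has_law P (fun w => (B k l w, B k l' w)) (fun z => q z.1 * q z.2).
  apply: has_law_pair => // y y'.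
  (* Mutual independence wants an event at every index. Only [(k, l)] and [(k, l')] are selected, so
     testing the instance number is enough to tell them apart. *)
  pose A (i : 'I_K + 'I_K * 'I_L) : set (scheme_val V W i) :=
    match i with inl _ => setT
    | inr kl => if kl.2 == l then [set y] else [set y'] end.
  have := indep (inr (k, l) |: [set inr (k, l')]) A.
  rewrite big_setU1 ?inE //=; last first.
    by apply: contra ll' => /eqP [->].
  rewrite big_set1 /= eqxx eq_sym (negPf ll') => <-; congr (P _).
  apply/seteqP; split=> w /=.
    move=> [wy wy'] i /=; rewrite !inE => /orP[] /eqP -> /=.
      by rewrite eqxx.
    by rewrite eq_sym (negPf ll').
  move=> h; split.
    by have := h (inr (k, l)); rewrite /= !inE !eqxx; apply.
  have := h (inr (k, l')); rewrite /= !inE !eqxx orbT eq_sym (negPf ll').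
  exact.
apply: (has_law_pair (lawb k) law2) => x [y y'].
rewrite law2.2 /= EFinM -(lawB k l).2 -(lawB k l').2.
pose A (i : 'I_K + 'I_K * 'I_L) : set (scheme_val V W i) :=
  match i with inl _ => [set x]
  | inr kl => if kl.2 == l then [set y] else [set y'] end.
have := indep (inl k |: (inr (k, l) |: [set inr (k, l')])) A.
rewrite !big_setU1 ?inE //=; last first.
  by apply: contra ll' => /eqP [->].
rewrite big_set1 /= eqxx eq_sym (negPf ll') => <-; congr (P _).
apply/seteqP; split=> w /=.
  move=> [wx [wy wy']] i /=; rewrite !inE => /or3P[] /eqP -> //=.
    by rewrite eqxx.
  by rewrite eq_sym (negPf ll').
move=> h; split; last (congr pair).
- by have := h (inl k); rewrite /= !inE !eqxx; apply.
- by have := h (inr (k, l)); rewrite /= !inE !eqxx; apply.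
have := h (inr (k, l')); rewrite /= !inE !eqxx !orbT eq_sym (negPf ll').
exact.
Qed.

Lemma scheme_law_distinct_shots k k' l l' : k != k' ->
  has_law P (fun w => ((b k w, B k l w), (b k' w, B k' l' w)))
    (fun z => (p z.1.1 * q z.1.2) * (p z.2.1 * q z.2.2)).
Proof.
move=> kk'.
apply: (has_law_pair (scheme_law k l) (scheme_law k' l')) => -[x y] [x' y'].
rewrite (scheme_law k l).2 (scheme_law k' l').2 /= !EFinM.
rewrite -(lawB k l).2 -(lawB k' l').2 -(lawb k).2 -(lawb k').2.
(* Here the shot number alone separates the four selected indices, even if [l] and [l'] coincide. *)
pose A (i : 'I_K + 'I_K * 'I_L) : set (scheme_val V W i) :=
  match i with inl j => if j == k then [set x] else [set x']
  | inr kl => if kl.1 == k then [set y] else [set y'] end.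
have := indep (inl k |: (inr (k, l) |: (inl k' |: [set inr (k', l')]))) A.
rewrite !big_setU1 ?inE //=; first last.
- by rewrite /= orbF; apply: contra kk' => /eqP [->].
- by apply: contra kk' => /eqP [->].
rewrite big_set1 /= eqxx eq_sym (negPf kk') muleA => <-; congr (P _).
apply/seteqP; split=> w /=.
  move=> [[wx wy] [wx' wy']] i /=; rewrite !inE => /or4P[] /eqP -> /=;
  by rewrite ?eqxx // eq_sym (negPf kk').
move=> h; split; congr pair.
- by have := h (inl k); rewrite /= !inE !eqxx; apply.
- by have := h (inr (k, l)); rewrite /= !inE !eqxx; apply.
- have := h (inl k'); rewrite /= !inE !eqxx !orbT eq_sym (negPf kk').
  exact.
have := h (inr (k', l')); rewrite /= !inE !eqxx !orbT eq_sym (negPf kk').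
exact.
Qed.

(** The squared centred sum expands into covariances of pairs of draws. Each is bounded by an
    uncentred second moment within a shot and vanishes across shots. *)
Lemma scheme_variance_le (e : V -> W -> R) : (0 < K)%N -> (0 < L)%N ->
  ('V_P[fun w => ((K%:R * L%:R)^-1 * \sum_(k < K) \sum_(l < L)
                    e (b k w) (B k l w))%R]
   <= (K%:R^-1 * (L%:R^-1 * (\sum_x p x * \sum_y q y * e x y ^+ 2)
        + (1 - L%:R^-1) * (\sum_x p x * (\sum_y q y * e x y) ^+ 2)))%R%:E)%E.
Proof.
move=> K0 L0.
have p1 : \sum_x p x = 1 := has_law_sum1 (lawb (Ordinal K0)).
have q1 : \sum_y q y = 1 := has_law_sum1 (lawB (Ordinal K0) (Ordinal L0)).
pose N : R := K%:R * L%:R.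
have N0 : N != 0 by rewrite mulf_neq0 // pnatr_eq0 -lt0n.
pose s x := \sum_y q y * e x y.
pose m := \sum_x p x * s x.
pose A := \sum_x p x * \sum_y q y * e x y ^+ 2.
pose D := \sum_x p x * s x ^+ 2.
(* All draws together form one finite-valued element [Z], so the mean of the estimators is a
   function of [Z] and the linearity lemmas apply to it. *)
pose VV := ({ffun 'I_K -> V} * {ffun 'I_K * 'I_L -> W})%type.
pose Z w : VV := ([ffun k => b k w], [ffun kl => B kl.1 kl.2 w]).
have mZ : discrete_rv Z.
  apply: discrete_rv_pair; apply: discrete_rv_ffun => i.
    exact: (lawb i).1.
  exact: (lawB i.1 i.2).1.
pose g (i : 'I_K * 'I_L) (z : VV) : R := e (z.1 i.1) (z.2 i).
pose G z := N^-1 * \sum_i g i z.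
have GE : (fun w => (K%:R * L%:R)^-1 * \sum_(k < K) \sum_(l < L)
             e (b k w) (B k l w)) = (fun w => G (Z w)).
  apply/funext => w; rewrite /G pair_bigA; congr (_ * _).
  by apply: eq_bigr => -[k l] _; rewrite /g /= !ffunE.
rewrite GE variance_discrete // lee_fin.
have Eg i : fine 'E_P[fun w => g i (Z w)]%E = m.
  have -> : (fun w => g i (Z w)) = (fun w => e (b i.1 w) (B i.1 i.2 w)).
    by apply/funext => w; rewrite /g /= !ffunE.
  rewrite (expectation_law (fun z => e z.1 z.2) (scheme_law i.1 i.2)) /=.
  rewrite -(pair_bigA _ (fun x y => e x y * (p x * q y))) /m /=.
  apply: eq_bigr => x _; rewrite /s mulr_sumr.
  by apply: eq_bigr => y _; ring.
have EG : fine 'E_P[fun w => G (Z w)]%E = m.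
  rewrite (expectation_discreteZ _ (fun z => \sum_i g i z)) //.
  rewrite expectation_discrete_sum // (eq_bigr (fun=> m)) // sumr_const.
  rewrite cardE /= -cardT card_prod !card_ord -mulr_natl natrM mulrA.
  by rewrite mulVf ?mul1r.
rewrite EG.
pose c i j z := (g i z - m) * (g j z - m).
have sqE : (fun w => (G (Z w) - m) ^+ 2)
    = (fun w => N ^- 2 * \sum_ij c ij.1 ij.2 (Z w)).
  apply/funext => w; rewrite -(pair_bigA _ (fun i j => c i j (Z w))) /=.
  rewrite /c -big_distrlr /= -expr2 sumrB sumr_const.
  rewrite cardE /= -cardT card_prod !card_ord -mulr_natl natrM -/N /G.
  by rewrite -exprVn -exprMn mulrBr mulrA mulVf // mul1r.
rewrite sqE (expectation_discreteZ _ (fun z => \sum_ij c ij.1 ij.2 z)) //.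
rewrite (expectation_discrete_sum (fun ij => c ij.1 ij.2)) //.
(* The three cases are the same draw, two instances of one shot, and two distinct shots. *)
pose bnd (i j : 'I_K * 'I_L) : R :=
  if i.1 == j.1 then if i.2 == j.2 then A else D else 0.
have centered x : \sum_y q y * (e x y - m) = s x - m.
  under eq_bigr do rewrite mulrBr.
  by rewrite sumrB -mulr_suml q1 mul1r.
have bndP i j : fine 'E_P[fun w => c i j (Z w)]%E <= bnd i j.
  case: i j => [k l] [k' l']; rewrite /bnd /=.
  have -> : (fun w => c (k, l) (k', l') (Z w)) =
      (fun w => (e (b k w) (B k l w) - m) * (e (b k' w) (B k' l' w) - m)).
    by apply/funext => w; rewrite /c /g /= !ffunE.
  have [<-|kk'] := eqVneq k k'; last first.
    rewrite (expectation_law (fun z => (e z.1.1 z.1.2 - m) * (e z.2.1 z.2.2 - m))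
      (scheme_law_distinct_shots l l' kk')) /=.
    (* The joint law of two shots is a product, so the covariance factors into the square of a
       centred mean, which is 0. *)
    pose h (z : V * W) := (e z.1 z.2 - m) * (p z.1 * q z.2).
    rewrite (eq_bigr (fun z => h z.1 * h z.2)); last by move=> z _; rewrite /h; ring.
    rewrite -(pair_bigA _ (fun z z' => h z * h z')) -big_distrlr /=.
    suff -> : \sum_z h z = 0 by rewrite mul0r.
    rewrite -(pair_bigA _ (fun x y => h (x, y))) /h /=.
    under eq_bigr => x _.
      under eq_bigr do rewrite mulrC -mulrA.
      rewrite -mulr_sumr centered mulrBr; over.
    by rewrite sumrB -mulr_suml p1 mul1r subrr.
  have [<-|ll'] := eqVneq l l'.
    rewrite (expectation_law (fun z => (e z.1 z.2 - m) * (e z.1 z.2 - m))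
      (scheme_law k l)) /=.
    rewrite -(pair_bigA _ (fun x y => (e x y - m) * (e x y - m) * (p x * q y))) /=.
    rewrite (eq_bigr (fun x => p x * \sum_y q y * e x y ^+ 2
        - 2 * m * (p x * s x) + m ^+ 2 * p x)); last first.
      move=> x _.
      rewrite (eq_bigr (fun y => p x * (q y * e x y ^+ 2)
        - 2 * m * p x * (q y * e x y) + m ^+ 2 * p x * q y)); last by move=> y _; ring.
      by rewrite big_split sumrB /= -!mulr_sumr q1 /s; ring.
    rewrite big_split sumrB /= -!mulr_sumr p1 -/A -/m.
    (* The covariance equals [A - m ^+ 2]; dropping the square leaves [A]. *)
    have := sqr_ge0 m; set M := m; lra.
  rewrite (expectation_law (fun z => (e z.1 z.2.1 - m) * (e z.1 z.2.2 - m))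
    (scheme_law_same_shot k ll')) /=.
  rewrite -(pair_bigA _ (fun x z => (e x z.1 - m) * (e x z.2 - m)
    * (p x * (q z.1 * q z.2)))) /=.
  rewrite (eq_bigr (fun x => p x * s x ^+ 2
      - 2 * m * (p x * s x) + m ^+ 2 * p x)); last first.
    move=> x _.
    rewrite -(pair_bigA _ (fun y y' => (e x y - m) * (e x y' - m)
      * (p x * (q y * q y')))) /=.
    (* Given the outcome [x] the two instances are independent, so the inner double sum is the
       square of the sum of [h], that is of [s x - m]. *)
    pose h y := q y * (e x y - m).
    under eq_bigr => y _.
      rewrite (eq_bigr (fun y' => p x * h y * h y')); last first.
        by move=> y' _; rewrite /h; ring.
      rewrite -mulr_sumr -mulrA mulrCA; over.
    by rewrite -mulr_suml /h centered /=; ring.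
  rewrite big_split sumrB /= -!mulr_sumr p1 -/D -/m.
  have := sqr_ge0 m; set M := m; lra.
(* A fixed draw meets itself once and [L - 1] other instances of its shot; the other shots
   contribute nothing. *)
have sum_bnd i : \sum_j bnd i j = A + (L%:R - 1) * D.
  rewrite -(pair_bigA _ (fun k l => bnd i (k, l))) /bnd /=.
  rewrite (bigD1 i.1) //= eqxx [X in _ + X]big1 ?addr0; last first.
    by move=> k /negPf ki; apply: big1 => l _; rewrite eq_sym ki.
  rewrite (bigD1 i.2) //= eqxx; congr (_ + _).
  rewrite (eq_bigr (fun=> D)); last by move=> l /negPf li; rewrite eq_sym li.
  rewrite sumr_const cardC1 card_ord -(mulr_natl D).
  by rewrite -subn1 natrB.
have le : \sum_ij fine 'E_P[fun w => c ij.1 ij.2 (Z w)]%E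
    <= N * (A + (L%:R - 1) * D).
  apply: (@le_trans _ _ (\sum_ij bnd ij.1 ij.2)).
    by apply: ler_sum => ij _; apply: bndP.
  rewrite -(pair_bigA _ bnd) /= (eq_bigr (fun=> A + (L%:R - 1) * D)) //.
  rewrite sumr_const cardE /= -cardT card_prod !card_ord -(mulr_natl (_ + _)) natrM.
  exact: lexx.
apply: (@le_trans _ _ (N ^- 2 * (N * (A + (L%:R - 1) * D)))).
  by rewrite ler_wpM2l ?invr_ge0 ?sqr_ge0.
rewrite -/A -/D /N le_eqVlt; apply/orP; left; apply/eqP; field.
by rewrite !pnatr_eq0 -!lt0n K0 L0.
Qed.

End scheme.

End finite_valued.

Section quantum.
Local Open Scope complex_scope.
Local Open Scope sesquilinear_scope.

(** * Positive semidefinite matrices and the spectral decomposition of Hermitian ones *)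

Section matrices.
Variable R : realType.

Lemma psd_mxblock1 m (X : 'M[R[i]]_m) :
  psd (\mxblock_(i < 1, j < 1) X) <-> psd X.
Proof.
split=> Xpsd v.
- have := Xpsd (\mxcol_(i < 1) v).
  have -> : (\mxcol_(i < 1) v)^t* = \mxrow_(i < 1) v^t*.
    by rewrite tr_mxcol; apply/matrixP => i j; rewrite !mxE.
  by rewrite mul_mxrow_mxblock mul_mxrow_mxcol big_ord1 big_ord1.
- rewrite -[v]submxcolK; set w := submxcol v.
  have -> : (\mxcol_(i < 1) w i)^t* = \mxrow_(i < 1) (w i)^t*.
    by rewrite tr_mxcol; apply/matrixP => i j; rewrite !mxE.
  by rewrite mul_mxrow_mxblock mul_mxrow_mxcol big_ord1 big_ord1.
Qed.

Lemma psd_conj m k (A : 'M[R[i]]_(k, m)) (X : 'M[R[i]]_m) :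
  psd X -> psd (A *m X *m A^t*).
Proof.
move=> Xpsd v; have := Xpsd (A^t* *m v).
by rewrite trmx_mul map_mxM trmxCK !mulmxA.
Qed.

Lemma psd_diag_ge0 m (X : 'M[R[i]]_m) j : psd X -> 0 <= X j j.
Proof.
move=> /(_ (delta_mx j 0)).
by rewrite trmx_delta map_delta_mx -rowE -colE !mxE.
Qed.

(** Eigenvectors are row vectors here. If [v] is one for [A], then [v *m invmx P] is one for the
    diagonal matrix, and any nonzero coordinate identifies the eigenvalue; conversely row [j] of [P]
    realises entry [j]. *)
Lemma eigenvalue_unitary_diag m (A P : 'M[R[i]]_m) (D : 'rV[R[i]]_m) :
  P \is unitarymx -> A = invmx P *m diag_mx D *m P ->
  forall a, eigenvalue A a <-> exists j, a = D 0 j.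
Proof.
move=> /unitarymx_unit Pu AE a; split.
- move=> /eigenvalueP [v vA v0]; pose w := v *m invmx P.
  have w0 : w != 0.
    apply: contra v0 => /eqP w0.
    by rewrite -[v](mulmxKV Pu) -/w w0 mul0mx.
  have wD : w *m diag_mx D = a *: w.
    have : v *m A *m invmx P = a *: v *m invmx P by rewrite vA.
    by rewrite AE !mulmxA -scalemxAl mulmxK.
  have [j wj] : exists j, w 0 j != 0.
    apply/existsP; apply: contraR w0; rewrite negb_exists => /forallP h.
    by apply/eqP/rowP => j; rewrite [RHS]mxE; apply/eqP; rewrite -[_ == _]negbK h.
  exists j; have /rowP/(_ j) := wD; rewrite mul_mx_diag mxE [RHS]mxE mulrC.
  by move=> h; apply: (mulIf wj); rewrite -h.
- move=> [j ->]; apply/eigenvalueP; exists (row j P); last first.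
    apply/eqP => r0; have := mulmxK Pu (delta_mx (0 : 'I_1) j).
    rewrite -rowE r0 mul0mx => /matrixP/(_ 0 j).
    by rewrite !mxE !eqxx => /eqP; rewrite eq_sym oner_eq0.
  rewrite AE rowE !mulmxA mulmxK // -(rowE j (diag_mx D)) row_diag_mx.
  by rewrite -scalemxAl.
Qed.

(** The spectral theorem, with the eigenvalues delivered in [R] so that they can be compared with
    real norms. *)
Lemma hermitian_diagonalizable m (G : 'M[R[i]]_m) : is_hermitian G ->
  exists (P : 'M[R[i]]_m) (D : 'I_m -> R),
    P \is unitarymx /\ G = P^t* *m diag_mx (\row_j (D j)%:C) *m P.
Proof.
move=> hG; have hG' : G \is hermsymmx.
  by apply/is_hermitianmxP; rewrite expr0 scale1r hG.
have Pu := spectral_unitarymx G.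
have GE := orthomx_spectralP (hermitian_normalmx hG').
have Dr := hermitian_spectral_diag_real hG'.
exists (spectralmx G), (fun j => complex.Re (spectral_diag G 0 j)).
split=> //; rewrite {1}GE (invmx_unitary Pu).
have -> : \row_j (complex.Re (spectral_diag G 0 j))%:C = spectral_diag G.
  apply/rowP => j; rewrite mxE; apply: RRe_real.
  by move/mxOverP: Dr; apply.
by [].
Qed.

(** For Hermitian [G] the Gram matrix is the square of [G], diagonal in the same basis; the singular
    values are thus the absolute values of the [D j]. *)
Lemma eigenvalue_sqr_unitary_diag m (G P : 'M[R[i]]_m) (D : 'I_m -> R) :
  P \is unitarymx -> is_hermitian G ->
  G = P^t* *m diag_mx (\row_j (D j)%:C) *m P ->
  forall a, eigenvalue (G^t* *m G) a <-> exists j, a = (D j ^+ 2)%:C.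
Proof.
move=> Pu hG GE a.
have G2 : G^t* *m G = invmx P *m diag_mx (\row_j (D j ^+ 2)%:C) *m P.
  have PP : P *m P^t* = 1%:M by apply/unitarymxP.
  have DD : diag_mx (\row_j (D j)%:C) *m diag_mx (\row_j (D j)%:C)
      = diag_mx (\row_j (D j ^+ 2)%:C) :> 'M[R[i]]_m.
    rewrite mulmx_diag; congr diag_mx; apply/rowP => j.
    by rewrite !mxE expr2 rmorphM.
  move: hG; rewrite /is_hermitian => ->.
  rewrite (invmx_unitary Pu) -DD GE; move: PP.
  move: (P^t*) (diag_mx _) => Q d PQ.
  by rewrite !mulmxA -(mulmxA _ P Q) PQ mulmx1.
rewrite (eigenvalue_unitary_diag Pu G2).
by split=> -[j ->]; exists j; rewrite mxE.
Qed.

End matrices.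

(** * Trace pairings bounded by the Schatten norm, and the outcome distribution of a state *)

Section superoperators.
Variables (R : realType) (n : nat).
Implicit Types (G X rho sigma : op R n) (Phi : superop R n) (b : bits n).

Lemma Re_ge0 (z : R[i]) : 0 <= z -> 0 <= complex.Re z.
Proof. by rewrite lecE => /andP[]. Qed.

Lemma ReZ (x : R) (z : R[i]) : complex.Re (x%:C * z) = x * complex.Re z.
Proof. by case: z => u v /=; rewrite mul0r subr0. Qed.

(** The case of a single block in the definition of complete positivity. *)
Lemma completely_positive_psd Phi X :
  completely_positive Phi -> psd X -> psd (Phi X).
Proof.
move=> /(_ 1 (\mxblock_(i < 1, j < 1) X)) cp /psd_mxblock1 /cp.
have -> : \mxblock_(i < 1, j < 1) Phi (submxblock (\mxblock_(i < 1, j < 1) X) i j)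
    = \mxblock_(i < 1, j < 1) Phi X.
  by apply: eq_mxblock => i j; rewrite mxblockK.
by move=> /psd_mxblock1.
Qed.

(** Every singular value is some [D j] in absolute value, hence at most the sum of them all.
    Boundedness is what makes [sup] dominate its members. *)
Lemma schatten_infty_has_ubound G : is_hermitian G ->
  has_ubound [set s : R | 0 <= s /\ eigenvalue (G^t* *m G) (s ^+ 2)%:C]%classic.
Proof.
move=> hG; have [P [D [Pu GE]]] := hermitian_diagonalizable hG.
exists (\sum_j `|D j|) => s [s0 /(eigenvalue_sqr_unitary_diag Pu hG GE) [j]].
move=> [sD]; rewrite -(ger0_norm s0).
have -> : `|s| = `|D j| by rewrite -!sqrtr_sqr sD.
by rewrite (bigD1 j) //= lerDl sumr_ge0.
Qed.

(** In an eigenbasis of [G] the trace is a combination of the eigenvalues whose weights, the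
    diagonal entries of the rotated [sigma], are nonnegative with sum at most 1. *)
Lemma abs_mxtrace_le_schatten G sigma : is_hermitian G -> psd sigma ->
  \tr sigma <= 1 -> `|complex.Re (\tr (G^t* *m sigma))| <= schatten_infty G.
Proof.
move=> hG spsd str; have [P [D [Pu GE]]] := hermitian_diagonalizable hG.
have D_le j : `|D j| <= schatten_infty G.
  apply: (ub_le_sup (schatten_infty_has_ubound hG)); split=> //.
  by apply/(eigenvalue_sqr_unitary_diag Pu hG GE); exists j; rewrite real_normK ?num_real.
(* The all-zero bit string shows that the index set is inhabited, even for [n = 0], so some [D j] is
   available. *)
have S0 : 0 <= schatten_infty G.
  exact: le_trans (normr_ge0 _) (D_le (enum_rank [tuple of nseq n false])).
pose Y := P *m sigma *m P^t*.
have Y0 j : 0 <= complex.Re (Y j j).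
  by apply/Re_ge0/psd_diag_ge0/psd_conj.
have trY : \tr Y = \tr sigma.
  rewrite /Y mxtrace_mulC mulmxA.
  have := Pu; rewrite -trmxC_unitary => /unitarymxP; rewrite trmxCK => ->.
  by rewrite mul1mx.
have -> : complex.Re (\tr (G^t* *m sigma)) = \sum_j D j * complex.Re (Y j j).
  rewrite hG GE -!mulmxA mxtrace_mulC -mulmxA -/Y mul_diag_mx.
  rewrite /mxtrace raddf_sum; apply: eq_bigr => j _.
  by rewrite !mxE -ReZ; congr (complex.Re (_ * _)); rewrite /Y -!mulmxA !mxE.
apply: le_trans (ler_norm_sum _ _ _) _.
apply: le_trans (_ : \sum_j schatten_infty G * complex.Re (Y j j) <= _).
  by apply: ler_sum => j _; rewrite normrM (ger0_norm (Y0 j)) ler_wpM2r.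
rewrite -mulr_sumr -[leRHS]mulr1 ler_wpM2l //.
have -> : \sum_j complex.Re (Y j j) = complex.Re (\tr sigma).
  by rewrite -trY /mxtrace raddf_sum.
by move: str; rewrite lecE => /andP[].
Qed.

Lemma braket_ketbra b Phi X :
  braket (ketbra R b) Phi X = Phi X (enum_rank b) (enum_rank b).
Proof.
rewrite /braket /ketbra trmx_delta map_delta_mx.
rewrite /mxtrace (bigD1 (enum_rank b)) //= big1 ?addr0 => [|j jb].
  by rewrite mxE (bigD1 (enum_rank b)) //= big1 ?addr0 => [|i ib];
    rewrite mxE ?eqxx ?mul1r // (negPf ib) andbF mul0r.
by rewrite mxE big1 // => i _; rewrite mxE (negPf jb) mul0r.
Qed.

(** The quadratic form at [v] is the squared modulus of the coordinate of [v] at [b]. *)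
Lemma ketbra_psd b : psd (ketbra R b).
Proof.
move=> v; rewrite /ketbra -(mul_delta_mx (0 : 'I_1)) mulmxA -mulmxA.
rewrite -rowE -colE !mxE big_ord1 !mxE.
by rewrite mulrC -normCK exprn_ge0.
Qed.

Lemma ketbra_trace b : \tr (ketbra R b) = 1.
Proof.
rewrite /mxtrace (bigD1 (enum_rank b)) //= big1 ?addr0 => [|j jb].
  by rewrite mxE eqxx.
by rewrite mxE (negPf jb).
Qed.

Lemma sum_bits (F : 'I_#|{: bits n}| -> R) : \sum_b F (enum_rank b) = \sum_j F j.
Proof. by rewrite [RHS](reindex enum_rank) //; apply/onW_bij/enum_rank_bij. Qed.

Lemma unitary_channel_density (U rho : op R n) : U \is unitarymx ->
  density rho -> density (unitary_channel U rho).
Proof.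
move=> Uu [rpsd rtr]; rewrite unitary_channelE; split; first exact: psd_conj.
rewrite mxtrace_mulC mulmxA.
have := Uu; rewrite -trmxC_unitary => /unitarymxP; rewrite trmxCK => ->.
by rewrite mul1mx.
Qed.

Lemma quantum_channel_density (E : superop R n) rho : quantum_channel E ->
  density rho -> density (E rho).
Proof.
by move=> [Ecp Etp] [rpsd rtr]; split; [apply: completely_positive_psd|rewrite Etp].
Qed.

Section outcome.
Variables (E UU : superop R n) (rho : op R n).
Hypothesis hsigma : density (E (UU rho)).

Lemma prbE b : prb E UU rho b = complex.Re (E (UU rho) (enum_rank b) (enum_rank b)).
Proof. by rewrite /prb /rbraket braket_ketbra comp_lfunE. Qed.

Lemma prb_ge0 b : 0 <= prb E UU rho b.
Proof. by rewrite prbE; apply/Re_ge0/psd_diag_ge0/hsigma.1. Qed.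

Lemma sum_prb : \sum_b prb E UU rho b = 1.
Proof.
under eq_bigr do rewrite prbE.
rewrite (sum_bits (fun j => complex.Re (E (UU rho) j j))).
by have := hsigma.2; rewrite /mxtrace => /(congr1 (@complex.Re R)); rewrite raddf_sum.
Qed.

(** The diagonal entries of a positive semidefinite matrix are real, so the real part taken in [prb]
    loses nothing. *)
Lemma dephasing_prb :
  dephasing R n (E (UU rho)) = \sum_b (prb E UU rho b)%:C *: ketbra R b.
Proof.
rewrite dephasingE; apply: eq_bigr => b _; congr (_ *: _).
have -> : \tr ((ketbra R b)^t* *m E (UU rho)) = braket (ketbra R b) E (UU rho) by [].
by rewrite prbE braket_ketbra RRe_real //; apply/ger0_real/psd_diag_ge0/hsigma.1.
Qed.

End outcome.

End superoperators.

Lemma diag_observable_hermitian (R : realType) n (f : bits n -> R) :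
  is_hermitian (diag_observable f).
Proof.
rewrite /is_hermitian /diag_observable; apply/matrixP => i j.
rewrite !mxE !summxE rmorph_sum; apply: eq_bigr => b _.
rewrite !mxE rmorphM andbC /=; congr (_ * _).
  exact: conjc_real.
by rewrite conjC_nat.
Qed.

(** * Sampling from the quasiprobability decomposition of the inverse of [E'] *)

Section quasiprobability.
Variables (R : realType) (n : nat) (BB : {fset superop R n}) (Q : BB -> R).
Hypothesis hBB : forall B : BB,
  completely_positive (val B) /\ trace_nonincreasing (val B).
Implicit Types (F G rho : op R n) (b : bits n) (B : BB).

Lemma prB_ge0 B : 0 <= prB Q B.
Proof. by rewrite divr_ge0 // sumr_ge0. Qed.

(* The sum is 0 when all the coefficients vanish. *)
Lemma sum_prB_le1 : \sum_B prB Q B <= 1.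
Proof.
rewrite /prB -mulr_suml -/(gamma Q).
by have [->|g0] := eqVneq (gamma Q) 0; rewrite ?mul0r // divff.
Qed.

(** The square is 1 except when [Q B = 0], where division by zero makes the sign 0. *)
Lemma sgnB_sqr_le1 B : sgnB Q B ^+ 2 <= 1.
Proof.
rewrite /sgnB expr_div_n real_normK ?num_real //.
have [->|Q0] := eqVneq (Q B) 0; first by rewrite expr0n mul0r.
by rewrite divff // sqrf_eq0.
Qed.

(** The importance-sampling identity: weighting by [gamma] and the sign restores the coefficient. A
    nonzero [Q B] forces [gamma] to be nonzero, and a zero one makes both sides 0. *)
Lemma prB_gamma_sgnB B : prB Q B * (gamma Q * sgnB Q B) = Q B.
Proof.
rewrite /prB /sgnB; have [QB0|Q0] := eqVneq (Q B) 0.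
  by rewrite QB0 normr0 !mul0r.
have nQ0 : `|Q B| != 0 by rewrite normr_eq0.
have g0 : gamma Q != 0.
  rewrite gt_eqF // /gamma (bigD1 B) //= ltr_pwDl ?normr_gt0 //.
  exact: sumr_ge0.
by field; rewrite nQ0 g0.
Qed.

Lemma abs_rbraket_le_schatten G b B : is_hermitian G ->
  `|rbraket G (val B) (ketbra R b)| <= schatten_infty G.
Proof.
move=> hG; apply: abs_mxtrace_le_schatten => //.
  exact: completely_positive_psd (hBB B).1 (ketbra_psd b).
by rewrite -(ketbra_trace R b); apply: (hBB B).2; apply: ketbra_psd.
Qed.

(** Jensen's inequality for weights whose sum is at most 1, read off from the nonnegativity of the
    weighted squared deviation from [t]. *)
Lemma sqr_sum_sgnB_le F b :
  (\sum_B prB Q B * sgnB Q B * rbraket F (val B) (ketbra R b)) ^+ 2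
  <= \sum_B prB Q B * rbraket F (val B) (ketbra R b) ^+ 2.
Proof.
pose r B := rbraket F (val B) (ketbra R b); pose x B := sgnB Q B * r B.
pose t := \sum_B prB Q B * x B.
have -> : \sum_B prB Q B * sgnB Q B * rbraket F (val B) (ketbra R b) = t.
  by apply: eq_bigr => B _; rewrite /x mulrA.
have : 0 <= \sum_B prB Q B * (x B - t) ^+ 2.
  by apply: sumr_ge0 => B _; rewrite mulr_ge0 ?prB_ge0 ?sqr_ge0.
rewrite (eq_bigr (fun B => prB Q B * x B ^+ 2
    - 2 * t * (prB Q B * x B) + t ^+ 2 * prB Q B)); last by move=> B _; ring.
rewrite big_split sumrB /= -!mulr_sumr -/t.
have xr : \sum_B prB Q B * x B ^+ 2 <= \sum_B prB Q B * r B ^+ 2.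
  apply: ler_sum => B _; rewrite ler_wpM2l ?prB_ge0 // exprMn -[leRHS]mul1r.
  by rewrite ler_wpM2r ?sqr_ge0 ?sgnB_sqr_le1.
have : t ^+ 2 * \sum_B prB Q B <= t ^+ 2.
  by rewrite -[leRHS]mulr1 ler_wpM2l ?sqr_ge0 ?sum_prB_le1.
rewrite -/(r _); lra.
Qed.

(** * Comparison of the semi-norms, moments of the one-shot estimator, and unbiasedness *)

Section norms.
Variables E UU : superop R n.
Hypothesis hE : forall rho, density rho -> density (E (UU rho)).

(** The radicand of [star_norm] at a single state; the variance bound needs it without the root. *)
Definition star_sqr G rho : R := \sum_b prb E UU rho b *
  \sum_B prB Q B * rbraket G (val B) (ketbra R b) ^+ 2.

Definition circ_sqr G rho : R := \sum_b prb E UU rho b *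
  (\sum_B prB Q B * sgnB Q B * rbraket G (val B) (ketbra R b)) ^+ 2.

Lemma circ_sqr_ge0 G rho : density rho -> 0 <= circ_sqr G rho.
Proof.
move=> hrho; apply: sumr_ge0 => b _; rewrite mulr_ge0 ?sqr_ge0 //.
exact: prb_ge0 (hE hrho) b.
Qed.

Lemma circ_sqr_le_star_sqr G rho : density rho ->
  circ_sqr G rho <= star_sqr G rho.
Proof.
move=> hrho; apply: ler_sum => b _; apply: ler_wpM2l.
  exact: prb_ge0 (hE hrho) b.
exact: sqr_sum_sgnB_le.
Qed.

(** Every bracket is at most the Schatten norm in absolute value; the outcome weights sum to 1 and
    the instance weights to at most 1. *)
Lemma star_sqr_le G rho : is_hermitian G -> density rho ->
  star_sqr G rho <= schatten_infty G ^+ 2.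
Proof.
move=> hG hrho; have p0 := prb_ge0 (hE hrho).
rewrite -[leRHS]mul1r -(sum_prb (hE hrho)) mulr_suml; apply: ler_sum => b _.
apply: ler_wpM2l => //.
apply: (@le_trans _ _ (\sum_B prB Q B * schatten_infty G ^+ 2)).
  apply: ler_sum => B _; apply: ler_wpM2l; first exact: prB_ge0.
  rewrite -real_normK ?num_real // lerXn2r ?nnegrE //.
    exact: le_trans (normr_ge0 _) (abs_rbraket_le_schatten b B hG).
  exact: abs_rbraket_le_schatten.
by rewrite -mulr_suml -[leRHS]mul1r ler_wpM2r ?sqr_ge0 ?sum_prB_le1.
Qed.

Lemma sqrt_star_sqr_le G rho : is_hermitian G -> density rho ->
  Num.sqrt (star_sqr G rho) <= schatten_infty G.
Proof.
move=> hG hrho.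
have S0 : 0 <= schatten_infty G.
  apply: le_trans (normr_ge0 _) (abs_mxtrace_le_schatten hG hrho.1 _).
  by rewrite hrho.2.
by rewrite -(ger0_norm S0) -sqrtr_sqr ler_wsqrtr // star_sqr_le.
Qed.

Lemma sqrt_star_sqr_le_star_norm G rho : is_hermitian G -> density rho ->
  Num.sqrt (star_sqr G rho) <= star_norm Q E UU G.
Proof.
move=> hG hrho; apply: ub_le_sup; last by exists rho.
by exists (schatten_infty G) => _ [rho' hrho' <-]; apply: sqrt_star_sqr_le.
Qed.

Lemma sqrt_circ_sqr_le_star_norm G rho : is_hermitian G -> density rho ->
  Num.sqrt (circ_sqr G rho) <= star_norm Q E UU G.
Proof.
move=> hG hrho; apply: le_trans (sqrt_star_sqr_le_star_norm hG hrho).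
by rewrite ler_wsqrtr // circ_sqr_le_star_sqr.
Qed.

(** The star norm serves as the upper bound that makes the supremum over states dominate each of its
    values. *)
Lemma sqrt_circ_sqr_le_circ_norm G rho : is_hermitian G -> density rho ->
  Num.sqrt (circ_sqr G rho) <= circ_norm Q E UU G.
Proof.
move=> hG hrho; apply: ub_le_sup; last by exists rho.
exists (star_norm Q E UU G) => _ [rho' hrho' <-].
exact: sqrt_circ_sqr_le_star_norm.
Qed.

(** The state [rho] witnesses that the sets are nonempty, so that a common upper bound passes to
    their suprema. *)
Lemma circ_star_schatten (rho : op R n) G : density rho -> is_hermitian G ->
  circ_norm Q E UU G <= star_norm Q E UU G <= schatten_infty G.
Proof.
move=> hrho hG; apply/andP; split; apply: ge_sup.
- by exists (Num.sqrt (circ_sqr G rho)), rho.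
- by move=> _ [rho' hrho' <-]; apply: sqrt_circ_sqr_le_star_norm.
- by exists (Num.sqrt (star_sqr G rho)), rho.
- by move=> _ [rho' hrho' <-]; apply: sqrt_star_sqr_le.
Qed.

Lemma star_sqr_le_star_norm G rho : is_hermitian G -> density rho ->
  star_sqr G rho <= star_norm Q E UU G ^+ 2.
Proof.
move=> hG hrho; have h := sqrt_star_sqr_le_star_norm hG hrho.
rewrite -(sqr_sqrtr (le_trans (circ_sqr_ge0 G hrho) (circ_sqr_le_star_sqr G hrho))).
by rewrite lerXn2r ?nnegrE ?sqrtr_ge0 // (le_trans _ h) ?sqrtr_ge0.
Qed.

Lemma circ_sqr_le_circ_norm G rho : is_hermitian G -> density rho ->
  circ_sqr G rho <= circ_norm Q E UU G ^+ 2.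
Proof.
move=> hG hrho; have h := sqrt_circ_sqr_le_circ_norm hG hrho.
rewrite -(sqr_sqrtr (circ_sqr_ge0 G hrho)).
by rewrite lerXn2r ?nnegrE ?sqrtr_ge0 // (le_trans _ h) ?sqrtr_ge0.
Qed.

Lemma sum_sgn_estimator F b :
  \sum_B prB Q B * estimator Q F b B =
  gamma Q * \sum_B prB Q B * sgnB Q B * rbraket F (val B) (ketbra R b).
Proof.
by rewrite mulr_sumr; apply: eq_bigr => B _; rewrite /estimator; ring.
Qed.

(** An inequality because the squared sign is 0, not 1, at vanishing coefficients. *)
Lemma sum_sqr_estimator_le F b :
  \sum_B prB Q B * estimator Q F b B ^+ 2 <=
  gamma Q ^+ 2 * \sum_B prB Q B * rbraket F (val B) (ketbra R b) ^+ 2.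
Proof.
rewrite mulr_sumr; apply: ler_sum => B _.
rewrite [leRHS]mulrCA ler_wpM2l ?prB_ge0 //.
have -> : estimator Q F b B ^+ 2
    = gamma Q ^+ 2 * (sgnB Q B ^+ 2 * rbraket F (val B) (ketbra R b) ^+ 2).
  by rewrite /estimator; ring.
by rewrite ler_wpM2l ?sqr_ge0 // -[leRHS]mul1r ler_wpM2r ?sqr_ge0 ?sgnB_sqr_le1.
Qed.

Lemma mean_estimator F b (E' : superop R n) :
  (E'^-1)%VF = \sum_(B : BB) (Q B)%:C *: val B ->
  \sum_B prB Q B * estimator Q F b B = rbraket F (E'^-1)%VF (ketbra R b).
Proof.
move=> ->; rewrite /rbraket /braket sum_lfunE mulmx_sumr (raddf_sum mxtrace) raddf_sum /=.
apply: eq_bigr => B _; rewrite scale_lfunE -scalemxAr mxtraceZ ReZ.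
by rewrite /estimator mulrA prB_gamma_sgnB.
Qed.

End norms.

(** The intertwining relation turns the dephased noisy state into [E'] of the dephased ideal state;
    the trivial kernel of [E'] lets its inverse cancel it. *)
Lemma estimator_unbiased F (E UU E' : superop R n) rho :
  density (E (UU rho)) -> lker E' == 0%VS ->
  (E' \o dephasing R n)%VF = (dephasing R n \o E)%VF ->
  (E'^-1)%VF = \sum_(B : BB) (Q B)%:C *: val B ->
  \sum_b prb E UU rho b * \sum_B prB Q B * estimator Q F b B
  = rbraket F (dephasing R n \o UU)%VF rho.
Proof.
move=> hsigma hE'inv hE' hQ.
under eq_bigr do rewrite (mean_estimator _ _ hQ).
have -> : rbraket F (dephasing R n \o UU)%VF rho
    = complex.Re (\tr (F^t* *m (E'^-1)%VF (dephasing R n (E (UU rho))))).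
  have -> : dephasing R n (E (UU rho)) = E' (dephasing R n (UU rho)).
    by rewrite -!comp_lfunE hE' comp_lfunE.
  by rewrite /rbraket /braket lker0_lfunK // comp_lfunE.
(* The dephased noisy state is the mixture of the [ketbra] with weights [prb], so linearity of the
   inverse yields the average over outcomes. *)
rewrite dephasing_prb // (linear_sum (E'^-1)%VF) mulmx_sumr (raddf_sum mxtrace) raddf_sum /=.
by apply: eq_bigr => b _; rewrite linearZ -scalemxAr mxtraceZ ReZ.
Qed.

End quasiprobability.

End quantum.

Theorem theorem1 (R : realType) (n : nat)
  (rho : op R n) (hrho : density rho)
  (U : op R n) (hU : U \is unitarymx)
  (E : superop R n) (hE : quantum_channel E)
  (f : bits n -> R)
  (BB : {fset superop R n})
  (hBB : forall B : BB,
     completely_positive (val B) /\ trace_nonincreasing (val B))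
  (E' : superop R n) (hE'inv : lker E' == 0%VS)
  (hE' : (E' \o dephasing R n)%VF = (dephasing R n \o E)%VF)
  (Q : BB -> R) (hQ : (E'^-1)%VF = \sum_(B : BB) (Q B)%:C%C *: val B) :
  let UU := unitary_channel U in
  let F := diag_observable f in
  [/\ (forall (d : measure_display) (T : measurableType d)
         (P : probability T R) (b : T -> bits n) (B : T -> BB),
         has_law P b (prb E UU rho) ->
         has_law P B (prB Q) ->
         independent P b B ->
         'E_P[fun w => estimator Q F (b w) (B w)]%E
         = (rbraket F (dephasing R n \o UU)%VF rho)%:E),
      (forall (d : measure_display) (T : measurableType d)
         (P : probability T R) (K L : nat)
         (b : 'I_K -> T -> bits n) (B : 'I_K -> 'I_L -> T -> BB),
         (0 < K)%N -> (0 < L)%N ->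
         (forall k, has_law P (b k) (prb E UU rho)) ->
         (forall k l, has_law P (B k l) (prB Q)) ->
         mutually_independent P (scheme_family b B) ->
         ('V_P[fun w => total_estimator Q F (b ^~ w) (fun k l => B k l w)]
          <= (gamma Q ^+ 2 / K%:R *
                (L%:R^-1 * star_norm Q E UU F ^+ 2
                 + (1 - L%:R^-1) * circ_norm Q E UU F ^+ 2))%R%:E)%E)
    & (forall G : op R n, is_hermitian G ->
         circ_norm Q E UU G <= star_norm Q E UU G <= schatten_infty G)].
Proof.
move=> UU F.
have hF : is_hermitian F by apply: diag_observable_hermitian.
have hdens rho' : density rho' -> density (E (UU rho')).
  by move=> h; apply/quantum_channel_density/unitary_channel_density.
split.
- move=> d T P b B lawb lawB indep.
  have law : has_law P (fun w => (b w, B w)) (fun z => prb E UU rho z.1 * prB Q z.2).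
    by apply: has_law_pair => // x y; apply: indep.
  rewrite (expectation_law (fun z => estimator Q F z.1 z.2) law) /=.
  rewrite -(estimator_unbiased F (hdens _ hrho) hE'inv hE' hQ); congr EFin.
  rewrite -(pair_bigA _ (fun x y => estimator Q F x y * (prb E UU rho x * prB Q y))) /=.
  apply: eq_bigr => x _; rewrite mulr_sumr.
  by apply: eq_bigr => y _; rewrite mulrC mulrA.
- move=> d T P K L b B K0 L0 lawb lawB indep.
  apply: le_trans (scheme_variance_le lawb lawB indep (estimator Q F) K0 L0) _.
  rewrite lee_fin (mulrC (_ ^+ 2)) -mulrA ler_wpM2l ?invr_ge0 //.
  (* Makes the weight [1 - L%:R^-1] nonnegative, so that the two moment bounds can be combined. *)
  have L1 : (L%:R : R)^-1 <= 1 by rewrite invf_le1 ?ler1n ?ltr0n.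
  have A_le : \sum_x prb E UU rho x * \sum_y prB Q y * estimator Q F x y ^+ 2
      <= gamma Q ^+ 2 * star_norm Q E UU F ^+ 2.
    apply: (@le_trans _ _ (gamma Q ^+ 2 * star_sqr Q E UU F rho)).
      rewrite mulr_sumr; apply: ler_sum => x _; rewrite mulrCA.
      apply: ler_wpM2l; first exact: prb_ge0 (hdens _ hrho) x.
      exact: sum_sqr_estimator_le.
    by rewrite ler_wpM2l ?sqr_ge0 ?star_sqr_le_star_norm.
  have D_le : \sum_x prb E UU rho x * (\sum_y prB Q y * estimator Q F x y) ^+ 2
      <= gamma Q ^+ 2 * circ_norm Q E UU F ^+ 2.
    (* This first comparison is an equality term by term, since [gamma] factors out of the inner
       mean exactly. *)
    apply: (@le_trans _ _ (gamma Q ^+ 2 * circ_sqr Q E UU F rho)).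
      rewrite mulr_sumr; apply: ler_sum => x _.
      by rewrite sum_sgn_estimator exprMn mulrCA.
    by rewrite ler_wpM2l ?sqr_ge0 ?circ_sqr_le_circ_norm.
  rewrite mulrDr (mulrCA _ L%:R^-1) (mulrCA _ (1 - _)).
  by rewrite lerD // ler_wpM2l ?invr_ge0 ?subr_ge0.
- by move=> G hG; apply: (circ_star_schatten Q hBB hdens hrho).
Qed.
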